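(* Let $\mathcal{H}=(V,E)$ be a hypergraph with $|V|=n\ge 2$, adjacency matrix $\mathbf{A}$, and let $\lambda_1$ be the largest eigenvalue of $\mathbf{A}$. Then $$\mathcal{E}(\mathcal{H})\ge\sqrt{\frac{n}{n-1}\lambda_1^2+n(n-1)|\det(\mathbf{A})|^{2/n}}.$$
   Context: A hypergraph $\mathcal{H}=(V,E)$ consists of a finite vertex set $V$ and a set $E$ of edges, each edge being a subset of $V$ of cardinality at least $2$ (distinct edges are distinct subsets). For $i\neq j$, $d(\{i,j\})$ is the number of edges containing both $i$ and $j$. The adjacency matrix $\mathbf{A}=\mathbf{A}(\mathcal{H})$ is the $n\times n$ matrix with zero diagonal and $(i,j)$ entry $d(\{i,j\})$ for $i\neq j$. The energy is $\mathcal{E}(\mathcal{H})=\sum_{i=1}^n|\lambda_i|$, where $\lambda_1\ge\dots\ge\lambda_n$ are the eigenvalues of $\mathbf{A}$. *)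

(* Defs.v *)
From mathcomp Require Import all_boot all_order all_algebra.
From mathcomp Require Import polyrcf.

Set Implicit Arguments.
Unset Strict Implicit.
Unset Printing Implicit Defensive.

Import Order.TTheory GRing.Theory Num.Theory.
Local Open Scope ring_scope.

Record hypergraph (V : finType) := Hypergraph {
  edges : {set {set V}};
  edges_card : forall e : {set V}, e \in edges -> (2 <= #|e|)%N
}.

Definition codegree (V : finType) (H : hypergraph V) (u v : V) : nat :=
  #|[set e in edges H | (u \in e) && (v \in e)]|.

(* Row or column i stands for the vertex enum_val i. *)
Definition adjacency (R : nzRingType) (V : finType) (H : hypergraph V) :
    'M[R]_#|V| :=
  \matrix_(i, j)
    (if i == j then 0 else (codegree H (enum_val i) (enum_val j))%:R).

(* The eigenvalues lying in R, each repeated according to its algebraic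
   multiplicity, in nonincreasing order.  For a symmetric A of order n these
   are all n eigenvalues. *)
Definition eigenvalues (R : rcfType) (n : nat) (A : 'M[R]_n) : seq R :=
  let p := char_poly A in
  sort >=%R (flatten [seq nseq (mup x p) x | x <- rootsR p]).

(* The default 0 is returned only if A has no eigenvalue in R. *)
Definition max_eigenvalue (R : rcfType) (n : nat) (A : 'M[R]_n) : R :=
  head 0 (eigenvalues A).

Definition energy (R : rcfType) (V : finType) (H : hypergraph V) : R :=
  \sum_(x <- eigenvalues (adjacency R H)) `|x|.

Lemma eigenvalues_sorted (R : rcfType) (n : nat) (A : 'M[R]_n) :
  sorted >=%R (eigenvalues A).
Proof. by apply: sort_sorted => x y; exact: le_total. Qed.

Lemma count_eigenvalues (R : rcfType) (n : nat) (A : 'M[R]_n) (x : R) :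
  count_mem x (eigenvalues A) = mup x (char_poly A).
Proof.
rewrite count_sort; set p := char_poly A.
have p0 : p != 0 by exact/monic_neq0/char_poly_monic.
rewrite count_flatten -map_comp sumnE big_map.
have uniq_roots : uniq (rootsR p) by exact/lt_sorted_uniq/sorted_roots.
have mem_roots : (x \in rootsR p) = root p x.
  by rewrite -(roots_on_rootsR p0) in_itv.
under eq_bigr do rewrite /= count_nseq.
have [rx | nrx] := boolP (root p x).
  rewrite (bigD1_seq x) ?mem_roots //= eqxx mul1n big1 ?addn0 // => y /negPf.
  by move=> ->.
rewrite (mupNroot nrx) big1_seq // => y /= y_root.
by have [yx|//] := eqVneq y x; rewrite yx mem_roots (negPf nrx) in y_root.
Qed.

(* Main.v *)
(* The adjacency matrix is real symmetric with zero diagonal, so its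
   characteristic polynomial splits over R and its eigenvalues sum to 0.  Hence
   Cauchy-Schwarz on the n - 1 eigenvalues other than lambda_1 bounds the sum of
   all the squares below by n/(n-1) lambda_1^2, while AM-GM bounds the
   off-diagonal part of the squared energy, the sum of |lambda_i| |lambda_j|
   over i != j, below by n(n-1) |det A|^(2/n). *)
Require Import Defs.
From mathcomp Require Import all_boot all_order all_algebra.
From mathcomp Require Import reals exp.
From mathcomp Require Import complex ring.
Import Order.TTheory GRing.Theory Num.Theory.
Local Open Scope ring_scope.

Lemma char_poly_conj (R : comUnitRingType) (n : nat) (P A : 'M[R]_n) :
  P \in unitmx -> char_poly (invmx P *m A *m P) = char_poly A.
Proof.
move=> Pu; pose f := @map_mx _ _ (@polyC R) n n.
have fVf : f (invmx P) *m f P = 1%:M by rewrite /f -map_mxM mulVmx // map_mx1.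
have -> : char_poly (invmx P *m A *m P)
          = \det (f (invmx P) *m char_poly_mx A *m f P).
  rewrite /char_poly /char_poly_mx /f mulmxBr mulmxBl -!map_mxM.
  by rewrite mul_mx_scalar -scalemxAl fVf scalemx1.
by rewrite !det_mulmx mulrAC -det_mulmx fVf det1 mul1r.
Qed.

(** Over [R[i]] the matrix is Hermitian, hence unitarily diagonalizable with a real diagonal. The
    real parts of that diagonal are the witness, and the factorization descends to [R] because the
    embedding is injective on polynomials. *)
Lemma char_poly_symmetric_split (R : rcfType) (n : nat) (A : 'M[R]_n) :
  A^T = A -> exists s : seq R, char_poly A = \prod_(x <- s) ('X - x%:P).
Proof.
move=> Asym; set A' : 'M[R[i]]_n := map_mx (real_complex R) A.
have A'herm : A' \is hermsymmx.
  apply: realsym_hermsym.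
    apply/is_hermitianmxP; rewrite expr0 scale1r map_mx_id //.
    by rewrite /A' map_trmx Asym.
  by apply/mxOverP => i j; rewrite mxE; apply/complex_realP; exists (A i j).
have A'E := orthomx_spectralP (hermitian_normalmx A'herm).
have /mxOverP dreal := hermitian_spectral_diag_real A'herm.
exists [seq complex.Re (spectral_diag A' 0 i) | i <- enum 'I_n].
apply: (map_poly_inj (real_complex R)).
rewrite map_char_poly -/A' [in LHS]A'E char_poly_conj ?spectral_unit //.
rewrite char_poly_trig ?diag_mx_is_trig // rmorph_prod big_map big_enum /=.
apply: eq_bigr => i _.
by rewrite rmorphB /= map_polyX map_polyC mxE eqxx mulr1n /= RRe_real.
Qed.

Lemma char_poly_eigenvalues (R : rcfType) (n : nat) (A : 'M[R]_n) :
  A^T = A -> char_poly A = \prod_(x <- eigenvalues A) ('X - x%:P).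
Proof.
move=> /char_poly_symmetric_split [s sE]; rewrite [LHS]sE; apply: perm_big.
(* Two lists are permutations of each other once all counts agree; here both counts of [x] are its
   multiplicity as a root. *)
by apply/allP => x _ /=; rewrite count_eigenvalues sE mu_prod_XsubC.
Qed.

Lemma size_eigenvalues (R : rcfType) (n : nat) (A : 'M[R]_n) :
  A^T = A -> size (eigenvalues A) = n.
Proof.
move=> /char_poly_eigenvalues /(congr1 (fun p : {poly R} => size p)).
by rewrite size_char_poly size_prod_XsubC => -[].
Qed.

Lemma sum_eigenvalues (R : rcfType) (n : nat) (A : 'M[R]_n) :
  A^T = A -> \sum_(x <- eigenvalues A) x = \tr A.
Proof.
(* Reading the trace off the coefficient of degree [n - 1] requires positive order, so order 0 is
   treated apart. *)
case: n A => [|n] A Asym; have szA := size_eigenvalues _ _ _ Asym.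
  by rewrite (size0nil szA) big_nil /mxtrace big_ord0.
have := char_poly_trace A (ltn0Sn n); rewrite char_poly_eigenvalues // => trE.
by apply: oppr_inj; rewrite -trE -coefPn_prod_XsubC szA.
Qed.

Lemma prod_eigenvalues (R : rcfType) (n : nat) (A : 'M[R]_n) :
  A^T = A -> \prod_(x <- eigenvalues A) x = \det A.
Proof.
move=> Asym; have := char_poly_det A.
rewrite char_poly_eigenvalues // coef0_prod_XsubC size_eigenvalues //.
by apply: mulfI; rewrite signr_eq0.
Qed.

(** With m the size, S the sum and Q the sum of squares, m (m Q - S^2) is the sum of the squares (m
    x - S)^2. Scaling the deviations from the mean by m avoids division. *)
Lemma sqr_sum_le (R : realDomainType) (s : seq R) :
  (\sum_(x <- s) x) ^+ 2 <= (size s)%:R * \sum_(x <- s) x ^+ 2.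
Proof.
have [/size0nil ->|s_gt0] := posnP (size s); first by rewrite !big_nil expr0n mulr0.
have m_gt0 : 0 < (size s)%:R :> R by rewrite ltr0n.
set S := \sum_(x <- s) x; set Q := \sum_(x <- s) x ^+ 2.
have varE a c : \sum_(x <- s) (a * x - c) ^+ 2
                = a ^+ 2 * Q - 2 * a * c * S + (size s)%:R * c ^+ 2.
  rewrite /S /Q; elim: (s) => [|x t IHt]; first by rewrite !big_nil /=; ring.
  by rewrite !big_cons IHt /= -natr1; ring.
rewrite -subr_ge0 -(pmulr_rge0 _ m_gt0).
have -> : (size s)%:R * ((size s)%:R * Q - S ^+ 2)
          = \sum_(x <- s) ((size s)%:R * x - S) ^+ 2 by rewrite varE; ring.
by apply: sumr_ge0 => x _; apply: sqr_ge0.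
Qed.

Lemma card_offdiag (I : finType) :
  #|[pred p : I * I | p.1 != p.2]| = (#|I| * #|I|.-1)%N.
Proof.
rewrite -sum1_card -(pair_big_dep xpredT (fun i j => i != j) (fun _ _ => 1%N)) /=.
rewrite -sum_nat_const; apply: eq_bigr => i _.
rewrite sum1_card -(cardC1 i); apply: eq_card => j.
by rewrite !inE eq_sym.
Qed.

(** Each [a i] occurs [#|I| - 1] times as a first factor and as often as a second factor. *)
Lemma prod_offdiag (R : comNzRingType) (I : finType) (a : I -> R) :
  \prod_(p : I * I | p.1 != p.2) (a p.1 * a p.2)
  = (\prod_i a i) ^+ (2 * #|I|.-1).
Proof.
rewrite -(pair_big_dep xpredT (fun i j => i != j) (fun i j => a i * a j)) /=.
have prodE : \prod_i \prod_(j | i != j) a i = (\prod_i a i) ^+ #|I|.-1.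
  rewrite -prodrXl; apply: eq_bigr => i _.
  rewrite prodr_const -(cardC1 i); congr (_ ^+ _); apply: eq_card => j.
  by rewrite !inE eq_sym.
under eq_bigr do rewrite big_split.
rewrite big_split /= prodE [X in _ * X](exchange_big_dep xpredT) //=.
under [X in _ * X]eq_bigr do under eq_bigl do rewrite eq_sym.
by rewrite prodE -exprD addnn mul2n.
Qed.

Lemma AGM_offdiag (R : realType) (I : finType) (a : I -> R) :
  (1 < #|I|)%N -> (forall i, 0 <= a i) ->
  #|I|%:R * (#|I|%:R - 1) * (\prod_i a i) `^ (2 / #|I|%:R)
  <= \sum_(p : I * I | p.1 != p.2) a p.1 * a p.2.
Proof.
move=> n_gt1 a_ge0; set n := #|I|; set S := \sum_(p | _) _.
have n_gt0 : 0 < n%:R :> R by rewrite ltr0n ltnW.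
have n1_gt0 : 0 < n%:R - 1 :> R by rewrite subr_gt0 ltr1n.
pose N := (n * n.-1)%N.
have NE : N%:R = n%:R * (n%:R - 1) :> R.
  by rewrite /N natrM -subn1 natrB // ltnW.
have N_gt0 : 0 < N%:R :> R by rewrite NE mulr_gt0.
have S_ge0 : 0 <= S by apply: sumr_ge0 => p _; rewrite mulr_ge0.
have P_ge0 : 0 <= \prod_i a i by apply: prodr_ge0.
rewrite -NE mulrC -ler_pdivlMr //.
have AGM : (\prod_i a i) ^+ (2 * n.-1) <= (S / N%:R) ^+ N.
  rewrite -prod_offdiag /N -card_offdiag.
  by apply: (leif_AGM (A := [pred p : I * I | p.1 != p.2])) => p _; rewrite mulr_ge0.
have SN_ge0 : 0 <= S / N%:R by rewrite divr_ge0 // ltW.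
(* Both sides become N-th roots, so that [AGM] applies under the monotone power 1/N; the exponents
   match since 2/n = 2(n-1)/N. *)
have -> : S / N%:R = ((S / N%:R) ^+ N) `^ N%:R^-1.
  by rewrite -powR_mulrn // -powRrM divff ?powRr1 // gt_eqF.
have -> : (2 / n%:R : R) = (2 * n.-1)%:R * N%:R^-1.
  rewrite NE natrM -subn1 natrB; last exact: ltnW.
  by field; rewrite !gt_eqF.
rewrite powRrM powR_mulrn //.
by apply: ge0_ler_powR; rewrite ?nnegrE ?exprn_ge0 ?invr_ge0 ?ler0n.
Qed.

Lemma sqr_sum_offdiag (R : comNzRingType) (I : finType) (a : I -> R) :
  (\sum_i a i) ^+ 2
  = \sum_i a i ^+ 2 + \sum_(p : I * I | p.1 != p.2) a p.1 * a p.2.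
Proof.
rewrite expr2 mulr_suml.
rewrite -(pair_big_dep xpredT (fun i j => i != j) (fun i j => a i * a j)) /=.
rewrite -big_split /=; apply: eq_bigr => i _.
rewrite mulr_sumr (bigD1 i) //= expr2; congr (_ + _).
by apply: eq_bigl => j; rewrite eq_sym.
Qed.

(** The tail, of size m, sums to minus the head y, so by Cauchy-Schwarz its squares sum to at least
    y^2/m; adding y^2 gives the factor 1 + 1/m = (m+1)/m. *)
Lemma sqr_head_le (R : realFieldType) (s : seq R) :
  (1 < size s)%N -> \sum_(x <- s) x = 0 ->
  (size s)%:R / ((size s)%:R - 1) * head 0 s ^+ 2 <= \sum_(x <- s) x ^+ 2.
Proof.
case: s => [//|y s]; rewrite !big_cons /= ltnS => s_gt0 sum0.
have m_gt0 : 0 < (size s)%:R :> R by rewrite ltr0n.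
have := sqr_sum_le _ s.
have -> : \sum_(x <- s) x = - y.
  by apply/eqP; rewrite -addr_eq0 addrC sum0.
rewrite sqrrN -ler_pdivrMl // => tail_ge.
have -> : (size s).+1%:R / ((size s).+1%:R - 1) * y ^+ 2
          = y ^+ 2 + (size s)%:R^-1 * y ^+ 2.
  by rewrite -natr1; field; rewrite gt_eqF.
by rewrite lerD2l.
Qed.

Theorem theorem33 (R : realType) (V : finType) (H : hypergraph V) (n : nat)
    (cardV : #|V| = n) (n_ge2 : (2 <= n)%N) :
  Num.sqrt (n%:R / (n%:R - 1) * max_eigenvalue (adjacency R H) ^+ 2
            + n%:R * (n%:R - 1) * (`|\det (adjacency R H)| `^ (2 / n%:R)))
  <= energy R H.
Proof.
rewrite -cardV in n_ge2 *; set A := adjacency R H.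
have Asym : A^T = A.
  apply/matrixP => i j; rewrite !mxE eq_sym; case: ifP => // _.
  congr (_%:R); apply: eq_card => e; rewrite !inE.
  by rewrite [X in _ && X]andbC.
have trA : \tr A = 0 by apply: big1 => i _; rewrite mxE eqxx.
have szA := size_eigenvalues _ _ _ Asym.
have prodA := prod_eigenvalues _ _ _ Asym.
have sumA := sum_eigenvalues _ _ _ Asym; rewrite trA in sumA.
rewrite /energy -/A /max_eigenvalue -prodA.
(* From here on the matrix is forgotten: what remains concerns a list [s] with sum 0. *)
move: (eigenvalues A) szA sumA {prodA} => s szs sum0; rewrite -szs in n_ge2 *.
have E_ge0 : 0 <= \sum_(x <- s) `|x| by apply: sumr_ge0.
rewrite -[leRHS](ger0_norm E_ge0) -[leRHS]sqrtr_sqr; apply: ler_wsqrtr.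
rewrite [in leRHS](big_nth 0) big_mkord sqr_sum_offdiag.
(* The diagonal squares dominate the [head 0 s] term, the off-diagonal products the determinant
   term. *)
apply: lerD.
  apply: le_trans (sqr_head_le _ _ n_ge2 sum0) _.
  rewrite (big_nth 0) big_mkord ler_sum // => i _.
  by rewrite real_normK ?num_real.
have := AGM_offdiag R _ (fun i : 'I_(size s) => `|s`_i|).
rewrite card_ord normr_prod (big_nth 0) big_mkord.
by apply.
Qed.
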